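(* Let $s>0$ and $0\le\alpha\le s$, let $\varepsilon>0$, and let $f=f^{cx}+f^{cv}$ be as in the context. Let $n$ be a positive even integer, $\tau>0$, $K\in\mathbb{N}$, and let $(u_n^k)_{k=0,\dots,K}\subset\mathcal{S}_n$ satisfy $$(-\Delta)^{-\alpha}d_tu_n^k+(-\Delta)^su_n^k+\varepsilon^{-2}I_nf^{cx}(u_n^k)=-\varepsilon^{-2}I_nf^{cv}(u_n^{k-1}),\qquad k=1,\dots,K,$$ where $d_tw^k=(w^k-w^{k-1})/\tau$. Then the scheme is unconditionally energy stable: for every $k=1,\dots,K$ (with no restriction on $\tau$ and $n$), $$|d_tu_n^k|_{-\alpha}^2+\frac\tau2|d_tu_n^k|_s^2+d_tE_\varepsilon^n(u_n^k)\le0,$$ where $E_\varepsilon^n(v_n)=\frac12\|(-\Delta)^{s/2}v_n\|^2+\varepsilon^{-2}\big(F(v_n),1\big)_n$ and $d_tE_\varepsilon^n(u_n^k)=\big(E_\varepsilon^n(u_n^k)-E_\varepsilon^n(u_n^{k-1})\big)/\tau$.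
   Context: $\mathbb{T}^d$, $d\ge1$, is the $2\pi$-periodic torus, and $(v,w)=\int_{\mathbb{T}^d}v\overline{w}\,dx$ with norm $\|\cdot\|$. Put $\varphi^k(x)=e^{\mathrm{i}k\cdot x}$ and $\hat v_k=(v,\varphi^k)$ for $k\in\mathbb{Z}^d$. For even $n$, $\mathbb{Z}_n^d=\{k\in\mathbb{Z}^d:-n/2\le k_i\le n/2-1\}$, $\mathbb{N}_n^d=\{j\in\mathbb{Z}^d:0\le j_i\le n-1\}$, grid points are $x_j=\frac{2\pi}{n}j$ for $j\in\mathbb{N}_n^d$, and $\mathcal{S}_n=\{\sum_{k\in\mathbb{Z}_n^d}c_k\varphi^k:c_k\in\mathbb{C}\}$. For a function $v$ given at the grid points, $I_nv\in\mathcal{S}_n$ is the trigonometric interpolant: $I_nv(x_j)=v(x_j)$ for all $j\in\mathbb{N}_n^d$. The discrete inner product is $(v,w)_n=\frac{(2\pi)^d}{n^d}\sum_{j\in\mathbb{N}_n^d}v(x_j)\overline{w(x_j)}$. For $r>0$, $(-\Delta)^rv=(2\pi)^{-d}\sum_{k\ne0}|k|^{2r}\hat v_k\varphi^k$. For $r<0$ the same formula is used for $v$ with $\hat v_0=0$. $(-\Delta)^0$ is the identity. The (semi)norms are $|v|_r=\|(-\Delta)^{r/2}v\|$; in particular $|v|_0=\|v\|$. If $\alpha>0$, the scheme is understood modulo constants, i.e. as an equality of the Fourier coefficients with $k\ne0$, together with mass conservation $(d_tu_n^k,1)=0$. If $\alpha=0$, it is a full equality in $\mathcal{S}_n$. Nonlinearity: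 $F:\mathbb{R}\to[0,\infty)$ is a nonnegative potential, $f=F'$, $F=F^{cx}+F^{cv}$ with $F^{cx}$ convex and $F^{cv}$ concave, $f^{cx}=(F^{cx})'$, $f^{cv}=(F^{cv})'$, and $f^{cx},f^{cv}$ are smooth and Lipschitz continuous. The iterates $u_n^k$ take real values at the grid points; only these nodal values enter $I_nf^{cx}(u_n^k)$, $I_nf^{cv}(u_n^{k-1})$ and $(F(u_n^k),1)_n$. *)

(* Defs.v *)
From HB Require Import structures.
From mathcomp Require Import all_boot all_order all_algebra.
From mathcomp Require Import all_classical all_reals all_analysis.
From mathcomp Require Export complex.

Set Implicit Arguments.
Unset Strict Implicit.
Unset Printing Implicit Defensive.

Import Order.TTheory GRing.Theory Num.Theory.
Import numFieldNormedType.Exports.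

Local Open Scope classical_set_scope.
Local Open Scope ring_scope.
Local Open Scope complex_scope.

(* The torus is represented by its fundamental domain [0, 2 pi]^d in R^d, and
   functions on it by functions on R^d.  [measurableTypeR R] is R with the
   sigma-algebra on which the library's [lebesgue_measure] is defined. *)
Notation Rd R d := (d.-tuple (measurableTypeR R)).

Section torus_measure_step.
Context (R : realType) (d : nat).

Lemma circle_lty :
  ((@lebesgue_measure R) `[0%R, (2 * pi)%R]%classic < +oo)%E.
Proof. by rewrite lebesgue_measure_itv/=; case: ifP; rewrite ?ltry. Qed.

Definition circle_measure :
    {finite_measure set (measurableTypeR R) -> \bar R} :=
  @mfrestr _ (measurableTypeR R) R _ (@lebesgue_measure R)
    (measurable_itv `[0%R, (2 * pi)%R]) circle_lty.

Definition consRd (p : measurableTypeR R * Rd R d) : Rd R d.+1 :=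
  [tuple of p.1 :: p.2].

Lemma measurable_consRd : measurable_fun setT consRd.
Proof. exact: (measurable_cons measurable_fst measurable_snd). Qed.

Variable mu : {finite_measure set (Rd R d) -> \bar R}.

Definition torus_step : set (Rd R d.+1) -> \bar R :=
  pushforward (circle_measure \x mu)%E consRd.

HB.instance Definition _ := Measure.copy torus_step
  (measure_function_pushforward__canonical__measure_function_Measure
     (circle_measure \x mu)%E measurable_consRd).

Lemma torus_step_fin : fin_num_fun torus_step.
Proof.
move=> A mA; rewrite ge0_fin_numE ?measure_ge0//.
apply: (@le_lt_trans _ _ (torus_step setT)).
  by apply: le_measure; rewrite ?inE.
rewrite /torus_step /pushforward preimage_setT -setXTT product_measure1E//.
by rewrite -ge0_fin_numE ?mule_ge0 ?measure_ge0// fin_numM ?fin_num_measure.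
Qed.

HB.instance Definition _ :=
  Measure_isFinite.Build _ _ _ torus_step torus_step_fin.

End torus_measure_step.

(* Lebesgue measure on [0, 2 pi]^d. *)
Fixpoint torus_measure (R : realType) (d : nat) :
    {finite_measure set (Rd R d) -> \bar R} :=
  if d is d'.+1 then torus_step (torus_measure R d')
  else \d_ ([tuple] : Rd R 0).

Section torus.
Context (R : realType) (d : nat).
Notation C := R[i].
Notation Zd := {ffun 'I_d -> int}.
Implicit Types (v w : Rd R d -> C) (k : Zd) (r : R) (n : nat).

Definition torus_integral v : C :=
  Rintegral (torus_measure R d) setT (fun x => complex.Re (v x)) +i*
  Rintegral (torus_measure R d) setT (fun x => complex.Im (v x)).

Definition inner v w : C := torus_integral (fun x => v x * (w x)^*).

Definition L2norm v : R := Num.sqrt (complex.Re (inner v v)).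

(* exp (i k.x) *)
Definition phi k : Rd R d -> C := fun x =>
  let t : R := \sum_(i < d) (k i)%:~R * (tnth x i : R) in cos t +i* sin t.

Definition fourier v k : C := inner v (phi k).

Definition Znorm k : R := Num.sqrt (\sum_(i < d) ((k i)%:~R) ^+ 2).

(* For r <> 0, the Fourier series is the pointwise limit of its partial sums
   over the cubes |k|_oo <= N; for a trigonometric polynomial v they are
   eventually constant. *)
Definition fracLap r v : Rd R d -> C := fun x =>
  if r == 0 then v x else
  ((2 * pi) ^- d)%:C *
  limn (fun N : nat =>
    \sum_(k \in [set k : Zd | k != 0 /\ forall i, `|k i| <= N%:Z])
      ((Znorm k `^ (2 * r))%:C * fourier v k * phi k x) : (C : numFieldType)).

Definition snorm r v : R := L2norm (fracLap (r / 2) v).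

Definition Zn n : set Zd :=
  [set k | forall i, - (n./2)%:Z <= k i <= (n./2)%:Z - 1].

Definition Sn n : set (Rd R d -> C) :=
  [set v | exists c : Zd -> C, v = fun x => \sum_(k \in Zn n) c k * phi k x].

(* The index set {0, ..., n-1}^d of the grid is [{ffun 'I_d -> 'I_n}]. *)
Definition grid n (j : {ffun 'I_d -> 'I_n}) : Rd R d :=
  [tuple 2 * pi / n%:R * (j i)%:R | i < d].

Definition interpolates n v p :=
  Sn n p /\ forall j : {ffun 'I_d -> 'I_n}, p (grid j) = v (grid j).

(* The interpolant exists and is unique for n even and positive, so the default
   value of [xget] plays no role. *)
Definition interp n v : Rd R d -> C :=
  xget (fun=> 0) [set p | interpolates n v p].

Definition inner_n n v w : C :=
  ((2 * pi) ^+ d / n%:R ^+ d)%:C *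
  \sum_(j : {ffun 'I_d -> 'I_n}) v (grid j) * (w (grid j))^*.

(* g(v) for a real nonlinearity g; only used at points where v is real. *)
Definition nonlin (g : R -> R) v : Rd R d -> C :=
  fun x => (g (complex.Re (v x)))%:C.

Definition energy (s eps : R) (F : R -> R) n v : R :=
  2^-1 * L2norm (fracLap (s / 2) v) ^+ 2 +
  eps ^- 2 * complex.Re (inner_n n (nonlin F v) (fun=> 1)).

Definition dt (tau : R) (w : nat -> Rd R d -> C) (m : nat) : Rd R d -> C :=
  fun x => (tau^-1)%:C * (w m x - w m.-1 x).

Definition scheme_lhs (s alpha eps tau : R) (fcx : R -> R) n
    (u : nat -> Rd R d -> C) (m : nat) : Rd R d -> C := fun x =>
  fracLap (- alpha) (dt tau u m) x + fracLap s (u m) x +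
  (eps ^- 2)%:C * interp n (nonlin fcx (u m)) x.

Definition scheme_rhs (eps : R) (fcv : R -> R) n
    (u : nat -> Rd R d -> C) (m : nat) : Rd R d -> C := fun x =>
  - ((eps ^- 2)%:C * interp n (nonlin fcv (u m.-1)) x).

(* For alpha > 0 the equation is only imposed modulo constants, and
   completed by mass conservation. *)
Definition scheme (s alpha eps tau : R) (fcx fcv : R -> R) n
    (u : nat -> Rd R d -> C) (m : nat) : Prop :=
  let lhs := scheme_lhs s alpha eps tau fcx n u m in
  let rhs := scheme_rhs eps fcv n u m in
  if alpha == 0 then lhs = rhs
  else (forall k : Zd, k != 0 -> fourier lhs k = fourier rhs k) /\
       inner (dt tau u m) (fun=> 1) = 0.

End torus.

Definition smooth (R : realType) (g : R -> R) :=
  forall (m : nat) (x : R), derivable (derive1n m g) x 1.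

Definition is_derivative (R : realType) (g g' : R -> R) :=
  forall x : R, is_derive x 1 g (g' x).

Definition convex_fun (R : realType) (g : R -> R) :=
  convex_function (setT : set R^o) g.

Definition concave_fun (R : realType) (g : R -> R) :=
  convex_fun (fun x => - g x).

Record nonlinearity (R : realType) (F f Fcx Fcv fcx fcv : R -> R) : Prop := {
  potential_ge0 : forall x, 0 <= F x;
  potential_deriv : is_derivative F f;
  potential_split : forall x, F x = Fcx x + Fcv x;
  convex_part : convex_fun Fcx;
  concave_part : concave_fun Fcv;
  convex_deriv : is_derivative Fcx fcx;
  concave_deriv : is_derivative Fcv fcv;
  nonlin_split : forall x, f x = fcx x + fcv x;
  fcx_smooth : smooth fcx;
  fcv_smooth : smooth fcv;
  fcx_lipschitz : lipschitz fcx;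
  fcv_lipschitz : lipschitz fcv }.

(* Main.v *)
Require Import Defs.
From mathcomp Require Import all_boot all_order all_algebra.
From mathcomp Require Import all_classical all_reals all_analysis.
From mathcomp Require Import measurable_realfun complex.
From mathcomp Require Import ring lra zify.
Import Order.TTheory GRing.Theory Num.Theory.
Import numFieldNormedType.Exports.

Local Open Scope classical_set_scope.
Local Open Scope ring_scope.
Local Open Scope complex_scope.

Set Implicit Arguments.
Unset Strict Implicit.
Unset Printing Implicit Defensive.

(** Test the scheme with [d_t u].  On [S_n] every term is diagonal in the basis
    [phi k], and the discrete inner product coincides with the continuous one, so
    the interpolants may be replaced by nodal values.  The fractional terms give
    [|d_t u|_{-alpha}^2] and, by polarization, [tau/2 |d_t u|_s^2] plus the discrete
    time derivative of the quadratic energy.  At each grid point the tangent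
    inequalities for [Fcx] (at the new value) and for [-Fcv] (at the old value) give
    [F x - F y <= (fcx x + fcv y) (x - y)], which controls the potential energy. *)

(** * Integration on the torus *)

Lemma Re_addc (R : realType) (x y : R[i]) :
  complex.Re (x + y) = complex.Re x + complex.Re y.
Proof. by case: x; case: y. Qed.

Lemma Im_addc (R : realType) (x y : R[i]) :
  complex.Im (x + y) = complex.Im x + complex.Im y.
Proof. by case: x; case: y. Qed.

Lemma Re_mulc (R : realType) (x y : R[i]) : complex.Re (x * y) =
  complex.Re x * complex.Re y - complex.Im x * complex.Im y.
Proof. by case: x; case: y. Qed.

Lemma Im_mulc (R : realType) (x y : R[i]) : complex.Im (x * y) =
  complex.Re x * complex.Im y + complex.Im x * complex.Re y.
Proof. by case: x; case: y. Qed.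

Lemma Re_sumc (R : realType) (I : finType) (F : I -> R[i]) :
  complex.Re (\sum_i F i) = \sum_i complex.Re (F i).
Proof. by elim/big_ind2: _ => // *; rewrite Re_addc; congr (_ + _). Qed.

(** * Unit complex exponentials *)

Definition cis (R : realType) (t : R) : R[i] := cos t +i* sin t.

Lemma cis0 (R : realType) : cis (0 : R) = 1.
Proof. by rewrite /cis cos0 sin0. Qed.

Lemma cisD (R : realType) (x y : R) : cis (x + y) = cis x * cis y.
Proof.
by rewrite /cis cosD sinD; apply/eqP; rewrite eq_complex /= addrC eqxx/= addrC.
Qed.

Lemma conj_cis (R : realType) (x : R) : Num.conj (cis x) = cis (- x).
Proof. by rewrite /cis cosN sinN. Qed.

Lemma cis_sum (R : realType) (I : finType) (F : I -> R) :
  cis (\sum_i F i) = \prod_i cis (F i).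
Proof. by elim/big_ind2: _ => [|? x ? y <- <-|//]; rewrite ?cis0 ?cisD. Qed.

Lemma cis_mulrn (R : realType) (x : R) (m : nat) : cis (x *+ m) = cis x ^+ m.
Proof. by elim: m => [|m IH]; rewrite ?cis0// mulrS exprS cisD IH. Qed.

Lemma cis_2pi_nat (R : realType) (m : nat) : cis (2 * pi * m%:R : R) = 1.
Proof.
rewrite mulr_natr cis_mulrn (_ : cis _ = 1) ?expr1n//.
by rewrite /cis mulr_natl cos2pi sin2pi.
Qed.

Lemma cis_2pi_int (R : realType) (m : int) : cis (2 * pi * m%:~R : R) = 1.
Proof.
case: m => m; first exact: cis_2pi_nat.
by rewrite NegzE mulrNz mulrN -conj_cis cis_2pi_nat rmorph1.
Qed.

(** * Linearity of the complex-valued integral *)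

Section complex_integral.
Context {dT} {T : measurableType dT} {R : realType}.
Variable mu : {measure set T -> \bar R}.

Definition cintegrable (f : T -> R[i]) :=
  mu.-integrable setT (EFin \o @complex.Re R \o f) /\
  mu.-integrable setT (EFin \o @complex.Im R \o f).

Definition cintegral (f : T -> R[i]) : R[i] :=
  Rintegral mu setT (fun x => complex.Re (f x)) +i*
  Rintegral mu setT (fun x => complex.Im (f x)).

(** Integrability and value are kept together because [Rintegral] is additive only on integrable
    functions; each rule below then transports both at once. *)
Definition has_cintegral (f : T -> R[i]) (z : R[i]) :=
  cintegrable f /\ cintegral f = z.

Lemma has_cintegralD f g a b : has_cintegral f a -> has_cintegral g b ->
  has_cintegral (fun x => f x + g x) (a + b).
Proof.
move=> [[f1 f2] <-] [[g1 g2] <-]; split; first split.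
- apply: eq_integrable (integrableD measurableT f1 g1) => // x _ /=.
  by rewrite Re_addc.
- apply: eq_integrable (integrableD measurableT f2 g2) => // x _ /=.
  by rewrite Im_addc.
rewrite /cintegral; apply/eqP; rewrite eq_complex /= -!RintegralD//.
by apply/andP; split; apply/eqP; apply: eq_Rintegral => x _;
  rewrite ?Re_addc ?Im_addc.
Qed.

Lemma has_cintegral0 : has_cintegral (fun=> 0) 0.
Proof.
split; first by split; exact: integrable0.
by apply/eqP; rewrite eq_complex/= !Rintegral_cst// !mul0r eqxx.
Qed.

Lemma has_cintegralZ c f a : has_cintegral f a ->
  has_cintegral (fun x => c * f x) (c * a).
Proof.
move=> [[f1 f2] <-].
have iZ k g : mu.-integrable setT (EFin \o @complex.Re R \o g) ->
    mu.-integrable setT (EFin \o (fun x => k * complex.Re (g x))).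
  move=> ig; apply: eq_integrable (integrableZl measurableT k ig) => // x _ /=.
have iZ' k g : mu.-integrable setT (EFin \o @complex.Im R \o g) ->
    mu.-integrable setT (EFin \o (fun x => k * complex.Im (g x))).
  move=> ig; apply: eq_integrable (integrableZl measurableT k ig) => // x _ /=.
split; first split.
- apply: eq_integrable (integrableB measurableT
    (iZ (complex.Re c) f f1) (iZ' (complex.Im c) f f2)) => // x _ /=.
  by rewrite Re_mulc EFinB.
- apply: eq_integrable (integrableD measurableT
    (iZ' (complex.Re c) f f2) (iZ (complex.Im c) f f1)) => // x _ /=.
  by rewrite Im_mulc EFinD.
rewrite /cintegral; apply/eqP; rewrite eq_complex /= Re_mulc Im_mulc /=.
rewrite -!(RintegralZl _ _ f1)//.
rewrite -!(RintegralZl _ _ f2)// -RintegralB//; [|exact: iZ|exact: iZ'].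
rewrite -RintegralD//; [|exact: iZ'|exact: iZ].
by apply/andP; split; apply/eqP; apply: eq_Rintegral => x _;
  rewrite ?Re_mulc ?Im_mulc.
Qed.

Lemma has_cintegral_sum (I : finType) (F : I -> T -> R[i]) (a : I -> R[i]) :
  (forall i, has_cintegral (F i) (a i)) ->
  has_cintegral (fun x => \sum_i F i x) (\sum_i a i).
Proof.
move=> Fa; elim: (index_enum I) => [|i s IH].
  rewrite big_nil (_ : (fun x => _) = fun=> 0) ?has_cintegral0//.
  exact: has_cintegral0.
  by apply/funext => x; rewrite big_nil.
rewrite big_cons (_ : (fun x => _) = fun x => F i x + \sum_(j <- s) F j x).
  exact: has_cintegralD.
by apply/funext => x; rewrite big_cons.
Qed.

End complex_integral.

(** * Fubini for products of functions of separate variables *)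

Section product_integral.
Context {d1 d2} {T1 : measurableType d1} {T2 : measurableType d2} {R : realType}.
Variables (mu1 : {finite_measure set T1 -> \bar R}).
Variables (mu2 : {finite_measure set T2 -> \bar R}).

(** Tonelli for [|f| |g|] bounds the iterated integral and gives integrability on the product;
    Fubini then applies, and the constant inner integral is pulled out. *)
Lemma Rintegral_prod (f : T1 -> R) (g : T2 -> R) :
  mu1.-integrable setT (EFin \o f) -> mu2.-integrable setT (EFin \o g) ->
  (mu1 \x mu2)%E.-integrable setT (EFin \o (fun z => f z.1 * g z.2)) /\
  Rintegral (mu1 \x mu2)%E setT (fun z => f z.1 * g z.2) =
  Rintegral mu1 setT f * Rintegral mu2 setT g.
Proof.
move=> intf intg.
have mf : measurable_fun setT f.
  by apply/measurable_EFinP; exact: measurable_int intf.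
have mg : measurable_fun setT g.
  by apply/measurable_EFinP; exact: measurable_int intg.
have mfg : measurable_fun setT (EFin \o (fun z : T1 * T2 => f z.1 * g z.2)).
  apply/measurable_EFinP; apply: measurable_funM.
  - exact: measurableT_comp mf measurable_fst.
  - exact: measurableT_comp mg measurable_snd.
have ifg : (mu1 \x mu2)%E.-integrable setT (EFin \o (fun z => f z.1 * g z.2)).
  apply/(integrable12ltyP _ _ mfg).
  have {}intf := integrable_norm intf; have {}intg := integrable_norm intg.
  rewrite [ltLHS](_ : _ = \int[mu1]_x
      ((fine (\int[mu2]_y (EFin \o (Num.norm \o g)) y))%:E *
       (EFin \o (Num.norm \o f)) x))%E.
    rewrite integralZl// -(fineK (integrable_fin_num measurableT intf)).
    by rewrite -EFinM ltry.
  apply: eq_integral => x _ /=.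
  rewrite fineK; last exact: (integrable_fin_num measurableT intg).
  rewrite muleC -integralZl//.
  by apply: eq_integral => y _ /=; rewrite normrM EFinM.
split=> //.
rewrite /Rintegral -(integral12_prod_meas1 ifg) /fubini_F /=.
transitivity (fine (\int[mu1]_x
   ((fine (\int[mu2]_y (EFin \o g) y))%:E * (EFin \o f) x))%E).
  congr fine; apply: eq_integral => x _ /=.
  rewrite fineK; last exact: (integrable_fin_num measurableT intg).
  rewrite muleC -integralZl//.
rewrite integralZl//= fineM//; last exact: (integrable_fin_num measurableT intf).
by rewrite mulrC.
Qed.

Lemma has_cintegral_prod (f : T1 -> R[i]) (g : T2 -> R[i]) a b :
  has_cintegral mu1 f a -> has_cintegral mu2 g b ->
  has_cintegral (mu1 \x mu2)%E (fun z => f z.1 * g z.2) (a * b).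
Proof.
move=> [[f1 f2] <-] [[g1 g2] <-].
have [i11 e11] := Rintegral_prod f1 g1.
have [i12 e12] := Rintegral_prod f1 g2.
have [i21 e21] := Rintegral_prod f2 g1.
have [i22 e22] := Rintegral_prod f2 g2.
split; first split.
- apply: eq_integrable (integrableB measurableT i11 i22) => // x _ /=.
  by rewrite Re_mulc EFinB.
- apply: eq_integrable (integrableD measurableT i12 i21) => // x _ /=.
  by rewrite Im_mulc EFinD.
rewrite /cintegral; apply/eqP; rewrite eq_complex /= -e11 -e12 -e21 -e22.
rewrite -RintegralB// -RintegralD//.
by apply/andP; split; apply/eqP; apply: eq_Rintegral => x _;
  rewrite ?Re_mulc ?Im_mulc.
Qed.

End product_integral.

Section torus_step_integral.
Context (R : realType) (d : nat).
Variable mu : {finite_measure set (Rd R d) -> \bar R}.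

(** Change of variables along [consRd], under which the integrand pulls back to a tensor product.
    The pushforward rule asks for measurability on the tuple side, so this is derived from the
    measurability of head and tail. *)
Lemma has_cintegral_torus_step (f : measurableTypeR R -> R[i]) (g : Rd R d -> R[i])
    a b : has_cintegral (circle_measure R) f a -> has_cintegral mu g b ->
  has_cintegral (torus_step mu) (fun x => f (thead x) * g (behead_tuple x)) (a * b).
Proof.
move=> fa gb.
have [[fg1 fg2] fgE] := has_cintegral_prod fa gb.
set h := fun x => _.
have hE : h \o @consRd R d = fun z => f z.1 * g z.2.
  apply/funext => -[x y]; rewrite /h /= /consRd; congr (_ * g _).
  by apply/val_inj.
have mth : measurable_fun setT (fun x : Rd R d.+1 => thead x).
  exact: measurable_tnth.
have mbh : measurable_fun setT (fun x : Rd R d.+1 => behead_tuple x : Rd R d).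
  apply/measurable_fun_tnthP => i.
  rewrite (_ : _ \o _ = fun x : Rd R d.+1 => tnth x (lift ord0 i)).
    exact: measurable_tnth.
  by apply/funext => x /=; rewrite tnth_behead; congr tnth; apply/val_inj;
     rewrite /= inordK// ltnS.
have [[/measurable_int/measurable_EFinP mf1
  /measurable_int/measurable_EFinP mf2] _] := fa.
have [[/measurable_int/measurable_EFinP mg1
  /measurable_int/measurable_EFinP mg2] _] := gb.
have mRe : measurable_fun setT (fun x => complex.Re (h x)).
  under eq_fun do rewrite /h Re_mulc.
  apply: measurable_funB; apply: measurable_funM.
  - exact: measurableT_comp mf1 mth.
  - exact: measurableT_comp mg1 mbh.
  - exact: measurableT_comp mf2 mth.
  - exact: measurableT_comp mg2 mbh.
have mIm : measurable_fun setT (fun x => complex.Im (h x)).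
  under eq_fun do rewrite /h Im_mulc.
  apply: measurable_funD; apply: measurable_funM.
  - exact: measurableT_comp mf1 mth.
  - exact: measurableT_comp mg2 mbh.
  - exact: measurableT_comp mf2 mth.
  - exact: measurableT_comp mg1 mbh.
rewrite -hE in fg1 fg2 fgE.
have mc := @measurable_consRd R d.
split; first split.
- apply: (integrable_pushforward mc _ fg1 measurableT).
  exact/measurable_EFinP.
- apply: (integrable_pushforward mc _ fg2 measurableT).
  exact/measurable_EFinP.
rewrite -fgE /cintegral /Rintegral /torus_step.
congr (fine _ +i* fine _).
- apply: (integral_pushforward mc _ fg1 measurableT).
  exact/measurable_EFinP.
- apply: (integral_pushforward mc _ fg2 measurableT).
  exact/measurable_EFinP.
Qed.

End torus_step_integral.

(** * Integrals over one period *)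

Section circle_integral.
Context (R : realType).
Local Notation mu := (@lebesgue_measure R).

(** [circle_measure] lives on the whole line and sends [A] to the length of its part in [[0, 2 pi]];
    the complement of the interval is therefore negligible, and inside it the two measures agree. *)
Lemma integral_circle (f : R -> R) :
  (circle_measure R).-integrable setT (EFin \o (f : measurableTypeR R -> R)) ->
  (\int[circle_measure R]_x (f x)%:E =
   \int[mu]_(x in `[0%R, (2 * pi)%R]) (f x)%:E)%E.
Proof.
move=> intf; set I := `[0, 2 * pi]%classic.
have mI : measurable (I : set (measurableTypeR R)) by exact: measurable_itv.
rewrite [LHS](negligible_integral (measurableC mI) measurableT intf); last first.
  by rewrite /circle_measure/= /mfrestr /mrestr setICl measure0.
rewrite setDE setCK setTI; apply: eq_measure_integral => A mA AI.
by rewrite /circle_measure/= /mfrestr /mrestr setIidl.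
Qed.

Lemma integrable_circle (f : R -> R) : continuous f -> (forall x, `|f x| <= 1) ->
  (circle_measure R).-integrable setT (EFin \o (f : measurableTypeR R -> R)).
Proof.
move=> cf f1; apply: measurable_bounded_integrable => //.
- by rewrite -ge0_fin_numE// fin_num_measure.
- exact: continuous_measurable_fun.
- exists 1; split=> // M M1 x _; exact: le_trans (f1 x) (ltW M1).
Qed.

Lemma Rintegral_circle_FTC (f F : R -> R) : continuous f ->
  (forall x, `|f x| <= 1) -> (forall x : R, is_derive x 1 F (f x)) ->
  Rintegral (circle_measure R) setT f = F (2 * pi) - F 0.
Proof.
move=> cf f1 dF; rewrite /Rintegral integral_circle; last exact: integrable_circle.
have cF : continuous F.
  move=> x; apply/differentiable_continuous/derivable1_diffP.
  exact: (@ex_derive _ _ _ _ _ _ _ (dF x)).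
rewrite (@continuous_FTC2 _ f F) //.
- by rewrite mulr_gt0// pi_gt0.
- exact: continuous_subspaceT.
- split.
  + by move=> x _; exact: (@ex_derive _ _ _ _ _ _ _ (dF x)).
  + exact/cvg_at_right_filter/cF.
  + exact/cvg_at_left_filter/cF.
- by move=> x _; rewrite derive1E; exact: (@derive_val _ _ _ _ _ _ _ (dF x)).
Qed.

Lemma has_cintegral_circle_cis (k : int) :
  has_cintegral (circle_measure R) (fun x => cis (k%:~R * x))
    (2 * pi * (k == 0)%:R)%:C.
Proof.
have ckx : continuous (fun x : R => k%:~R * x).
  by move=> x; exact: mulrl_continuous.
have cc : continuous (fun x : R => cos (k%:~R * x)).
  move=> x; apply: continuous_comp; [exact: ckx | exact: continuous_cos].
have cs : continuous (fun x : R => sin (k%:~R * x)).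
  move=> x; apply: continuous_comp; [exact: ckx | exact: continuous_sin].
have ic := integrable_circle cc (fun x => cos_max _).
have isn := integrable_circle cs (fun x => sin_max _).
split=> //; rewrite /cintegral /=.
have [->|k0] := eqVneq k 0.
  under eq_Rintegral do rewrite mul0r cos0.
  under [X in _ +i* X]eq_Rintegral do rewrite mul0r sin0.
  rewrite (Rintegral_circle_FTC (F := id)) ?subr0 ?mulr1//; last 2 first.
    by move=> x; exact: cvg_cst.
    by move=> x; rewrite normr1.
  by rewrite Rintegral_cst// mul0r.
have kR : k%:~R != 0 :> R by rewrite intr_eq0.
have kxd (x : R) : is_derive x 1 (fun x : R => k%:~R * x) k%:~R.
  apply: is_derive_eq (is_deriveZ k%:~R (is_derive_id x (1 : R))) _.
  exact: mulr1.
(* For [k != 0] the antiderivatives [sin (k x) / k] and [- cos (k x) / k] are available. *)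
have dS (x : R) : is_derive x 1 (k%:~R^-1 \*: (sin \o *%R k%:~R)) (cos (k%:~R * x)).
  apply: is_derive_eq (is_deriveZ _ (is_derive1_comp _ (kxd x))) _.
  by rewrite /GRing.scale/= [X in _ * X]mulrC mulrA mulVf ?mul1r.
have dC (x : R) :
    is_derive x 1 (- k%:~R^-1 \*: (cos \o *%R k%:~R)) (sin (k%:~R * x)).
  apply: is_derive_eq (is_deriveZ _ (is_derive1_comp _ (kxd x))) _.
  rewrite /GRing.scale/= !mulNr mulrN opprK.
  by rewrite [X in _ * X]mulrC mulrA mulVf ?mul1r.
rewrite (Rintegral_circle_FTC cc (fun x => cos_max _) dS).
rewrite (Rintegral_circle_FTC cs (fun x => sin_max _) dC).
rewrite /GRing.scale/=.
(* By periodicity both antiderivatives take equal values at [0] and [2 pi]. *)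
have := cis_2pi_int R k; rewrite mulrC => -[-> ->].
by rewrite !mulr0 sin0 cos0 scaler0 !subrr.
Qed.

End circle_integral.

(** Induction on the dimension: [phi k] splits into a character of the first coordinate and one of
    the remaining ones, and the integral factors accordingly. *)
Lemma has_cintegral_phi (R : realType) (d : nat) (k : {ffun 'I_d -> int}) :
  has_cintegral (torus_measure R d) (phi k) ((2 * pi) ^+ d * (k == 0)%:R)%:C.
Proof.
elim: d k => [|d IH] k.
  (* In dimension zero the torus is one point of mass 1 and the only frequency is 0. *)
  have -> : phi k = (fun=> 1) :> (Rd R 0 -> R[i]).
    by apply/funext => x; rewrite -(cis0 R); congr cis; rewrite big_ord0.
  have -> : k = 0 by apply/ffunP => -[].
  split; first split.
  - exact: finite_measure_integrable_cst.
  - exact: finite_measure_integrable_cst.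
  rewrite /cintegral !Rintegral_cst//= indicT.
  by rewrite (eqxx (0 : {ffun _ -> _})) expr0 !mul1r mul0r.
pose k' : {ffun 'I_d -> int} := [ffun i : 'I_d => k (lift ord0 i)].
have -> : phi k = (fun x : Rd R d.+1 =>
    cis ((k ord0)%:~R * thead x) * phi k' (behead_tuple x)).
  apply/funext => x; rewrite -cisD; congr cis; rewrite big_ord_recl; congr (_ + _).
  apply: eq_bigr => i _; rewrite ffunE tnth_behead; congr (_ * tnth _ _).
  by apply/val_inj; rewrite /= inordK// ltnS.
have -> : ((2 * pi) ^+ d.+1 * (k == 0)%:R)%:C =
    (2 * pi * (k ord0 == 0)%:R)%:C * ((2 * pi) ^+ d * (k' == 0)%:R)%:C :> R[i].
  rewrite -rmorphM; congr (_%:C).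
  have -> : (k == 0) = (k ord0 == 0) && (k' == 0).
    apply/eqP/andP => [k0|[/eqP k0 /eqP k'0]].
      split; apply/eqP; first by rewrite k0 ffunE.
      by apply/ffunP => i; rewrite !ffunE k0 ffunE.
    apply/ffunP => i; rewrite ffunE; case: (unliftP ord0 i) => [j|] -> //.
    by have /ffunP/(_ j) := k'0; rewrite !ffunE.
  by rewrite -mulnb natrM exprS; ring.
exact: has_cintegral_torus_step (has_cintegral_circle_cis R (k ord0)) (IH k').
Qed.

(** * Trigonometric polynomials *)

Section trigonometric_polynomials.
Context (R : realType) (d n : nat).
Hypothesis n_even : ~~ odd n.
Local Notation M := {ffun 'I_d -> 'I_n}.
Local Notation Zd := {ffun 'I_d -> int}.
Local Notation vol := (((2 * pi) ^+ d)%:C : R[i]).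

(* Identifies [Zn n] with [{0, ..., n-1}^d] by the shift [n/2]. *)
Definition freq (m : M) : Zd := [ffun i => (m i)%:Z - (n./2)%:Z].

(** Coefficients are indexed by the finite type [M], so that elements of [Sn n] become ordinary
    finite sums; [SnP] makes the link. *)
Definition trig (c : M -> R[i]) : Rd R d -> R[i] :=
  fun x => \sum_m c m * phi (freq m) x.

Lemma freq_inj : injective freq.
Proof.
move=> m m' /ffunP e; apply/ffunP => i; apply/val_inj.
by have := e i; rewrite !ffunE => /addIr[].
Qed.

Lemma ZnE : Zn n = freq @` [set: M].
Proof.
have n2 : (n = n./2 + n./2)%N by rewrite addnn even_halfK.
apply/seteqP; split => [k kn|_ [m _ <-] i]; last first.
  by have := ltn_ord (m i); rewrite ffunE; lia.
have mP i : (absz (k i + (n./2)%:Z)%R < n)%N by have := kn i; lia.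
exists [ffun i => Ordinal (mP i)] => //; apply/ffunP => i.
by rewrite !ffunE /=; have := kn i; lia.
Qed.

Lemma fsum_Zn (F : Zd -> R[i]) : \sum_(k \in Zn n) F k = \sum_m F (freq m).
Proof.
rewrite ZnE fsbig_image; last by move=> x y _ _; exact: freq_inj.
rewrite [RHS]fsbig_seq ?index_enum_uniq//; apply: eq_fsbigl.
by apply/seteqP; split=> m //= _; rewrite mem_index_enum.
Qed.

Lemma SnP (v : Rd R d -> R[i]) : Sn n v <-> exists c, v = trig c.
Proof.
split=> [[c ->]|[c ->]].
  by exists (c \o freq); apply/funext => x; rewrite fsum_Zn.
(* This sum extends [c] from the range of [freq] to all of [Zd]: by injectivity it has at most one
   term, and it is 0 off the range. *)
exists (fun k => \sum_(m | freq m == k) c m); apply/funext => x.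
rewrite fsum_Zn; apply: eq_bigr => m _; congr (_ * _).
by rewrite (big_pred1 m)// => m'; rewrite (inj_eq freq_inj).
Qed.

Lemma phiE (k : Zd) (x : Rd R d) :
  phi k x = cis (\sum_(i < d) (k i)%:~R * (tnth x i : R)).
Proof. by []. Qed.

Lemma mulr_phi_conj (k l : Zd) (x : Rd R d) : phi k x * (phi l x)^* = phi (k - l) x.
Proof.
rewrite !phiE conj_cis -cisD; congr cis.
rewrite -sumrN -big_split; apply: eq_bigr => i _.
by rewrite !ffunE intrB mulrBl.
Qed.

Lemma has_cintegral_trig_phi (c : M -> R[i]) (k : Zd) :
  has_cintegral (torus_measure R d) (fun x => trig c x * (phi k x)^*)
    (vol * \sum_m c m * (freq m == k)%:R).
Proof.
rewrite mulr_sumr (_ : (fun x => _) = fun x => \sum_m c m * phi (freq m - k) x).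
  apply: has_cintegral_sum => m; rewrite mulrCA; apply: has_cintegralZ.
  have := has_cintegral_phi R (freq m - k); by rewrite subr_eq0 rmorphM rmorph_nat.
apply/funext => x; rewrite /trig mulr_suml; apply: eq_bigr => m _.
by rewrite -mulrA mulr_phi_conj.
Qed.

Lemma fourier_trig (c : M -> R[i]) (k : Zd) :
  fourier (trig c) k = vol * \sum_m c m * (freq m == k)%:R.
Proof. by have [_ <-] := has_cintegral_trig_phi c k. Qed.

Lemma fourier_trig_freq (c : M -> R[i]) m :
  fourier (trig c) (freq m) = vol * c m.
Proof.
rewrite fourier_trig (bigD1 m)//= eqxx mulr1 big1 ?addr0// => m' m'm.
by rewrite (inj_eq freq_inj) (negbTE m'm) mulr0.
Qed.

(** Parseval's identity: only the second factor is expanded, which leaves the Fourier coefficients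
    of [trig c]. *)
Lemma inner_trig (c e : M -> R[i]) :
  inner (trig c) (trig e) = vol * \sum_m c m * (e m)^*.
Proof.
suff [_ <-] : has_cintegral (torus_measure R d) (fun x => trig c x * (trig e x)^*)
    (vol * \sum_m c m * (e m)^*) by [].
rewrite (_ : (fun x => _) =
    fun x => \sum_m (e m)^* * (trig c x * (phi (freq m) x)^*)); last first.
  apply/funext => x; rewrite {2}/trig rmorph_sum mulr_sumr.
  by apply: eq_bigr => m _; rewrite rmorphM mulrCA.
rewrite mulr_sumr; apply: has_cintegral_sum => m.
rewrite mulrA mulrC; apply: has_cintegralZ.
by rewrite -fourier_trig_freq fourier_trig; exact: has_cintegral_trig_phi.
Qed.

Lemma vol_neq0 : vol != 0.
Proof.
by rewrite (inj_eq (@complexI R)) expf_neq0// mulf_neq0// lt0r_neq0// pi_gt0.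
Qed.

Lemma trig_inj (c e : M -> R[i]) : trig c = trig e -> c =1 e.
Proof.
move=> ce m; apply: (mulfI vol_neq0).
by rewrite -!fourier_trig_freq ce.
Qed.

(* Fourier multiplier of [fracLap r]: for [r <> 0] the zero mode is dropped. *)
Definition symbol (r : R) (k : Zd) : R :=
  if r == 0 then 1 else if k == 0 then 0 else Znorm R k `^ (2 * r).

Lemma fracLap_trig r (c : M -> R[i]) :
  fracLap r (trig c) = trig (fun m => (symbol r (freq m))%:C * c m).
Proof.
apply/funext => x; rewrite /fracLap /trig /symbol; case: eqP => [_|r0].
  by apply: eq_bigr => m _; rewrite mul1r.
rewrite (_ : \sum_m _ = ((2 * pi) ^- d)%:C * \sum_m
   (if freq m == 0 then 0 else
     (Znorm R (freq m) `^ (2 * r))%:C * fourier (trig c) (freq m) *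
     phi (freq m) x)); last first.
  rewrite mulr_sumr; apply: eq_bigr => m _; case: eqP => _.
    by rewrite !mul0r mulr0.
  have volV : ((2 * pi) ^- d)%:C * vol = 1.
    by rewrite -rmorphM mulVf// -(inj_eq (@complexI R)) vol_neq0.
  rewrite fourier_trig_freq -[LHS]mul1r -volV.
  by rewrite [_%:C * (vol * _)]mulrCA -!mulrA.
congr (_ * _); apply: (@lim_near_cst (R[i] : numFieldType)).
  exact: norm_hausdorff.
(* Frequencies in [Zn n] have entries of size at most [n/2], so from [N = n] on the cube contains
   all of them and the partial sums are constant. *)
exists n => // N /= nN.
set T := (fun k : Zd => (Znorm R k `^ (2 * r))%:C * fourier (trig c) k * phi k x).
set A := [set k | _].
(* Outside [Zn n] the Fourier coefficients of [trig c] vanish. *)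
rewrite -(@fsbig_widen _ _ _ _ (A `&` Zn n)) //; last first.
  move=> k [Ak /= nk]; have kn : ~ Zn n k by move=> kn; apply: nk.
  rewrite fourier_trig big1 ?mulr0 ?mul0r// => m _.
  case: eqP => [mk|_]; last by rewrite mulr0.
  by exfalso; apply: kn; rewrite ZnE -mk; exists m.
rewrite fsbig_mkcondl fsum_Zn; apply: eq_bigr => m _.
case: ifPn => [/set_mem [/negbTE -> _]//|/negP mA].
case: eqP => // m0; exfalso; apply: mA; apply/mem_set; split; first exact/eqP.
by move=> i; rewrite ffunE; move: (nat_of_ord (m i)) (ltn_ord (m i)) => a; lia.
Qed.

End trigonometric_polynomials.

(** * Discrete orthogonality and interpolation *)

(** Conjugation reduces to [t > 0]. If [cos t = 1], the double-angle formula forces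
    [sin (t / 2) = 0], whereas [t / 2] lies strictly between 0 and [pi]. *)
Lemma cis_neq1 (R : realType) (t : R) : 0 < `|t| < 2 * pi -> cis t != 1.
Proof.
wlog t0 : t / 0 <= t => [H tP|].
  have [/H|t0] := leP 0 t; first exact.
  apply: contra_neq (H (- t) _ _); rewrite ?normrN// ?oppr_ge0 ?ltW// => t1.
  by rewrite -conj_cis t1 rmorph1.
rewrite ger0_norm// => /andP[t_gt0 t_lt]; apply/eqP => -[cost _].
have : 0 < sin (t / 2) by apply: sin_gt0_pi; lra.
have := cos_mulr2n (t / 2); have := cos2Dsin2 (t / 2).
rewrite (_ : t / 2 *+ 2 = t) ?cost; [nra | by rewrite mulr2n -splitr].
Qed.

Section discrete_orthogonality.
Context (R : realType) (d n : nat).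
Hypothesis n_gt0 : (0 < n)%N.
Hypothesis n_even : ~~ odd n.
Local Notation M := {ffun 'I_d -> 'I_n}.
Local Notation vol := (((2 * pi) ^+ d)%:C : R[i]).

(** For [p != q] this is a geometric sum of powers of an [n]-th root of unity [z != 1], and
    [(z - 1)] times the sum is [z ^+ n - 1 = 0]. *)
Lemma sum_cis_roots (p q : 'I_n) :
  \sum_(a < n) cis (2 * pi / n%:R * a%:R * (p%:R - q%:R) : R) = n%:R * (p == q)%:R.
Proof.
have nR : n%:R != 0 :> R by rewrite pnatr_eq0 -lt0n.
have [->|pq] := eqVneq p q.
  rewrite (eq_bigr (fun=> 1)) ?mulr1; first by rewrite sumr_const card_ord.
  by move=> a _; rewrite subrr mulr0 cis0.
rewrite mulr0; pose z := cis (2 * pi / n%:R * (p%:R - q%:R) : R).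
rewrite (eq_bigr (fun a : 'I_n => z ^+ a)); last first.
  by move=> a _; rewrite -cis_mulrn -[_ *+ a]mulr_natr; congr cis; ring.
have zn : z ^+ n = 1.
  rewrite -cis_mulrn -(cis_2pi_int R (p%:Z - q%:Z)) -[_ *+ n]mulr_natr.
  by congr cis; rewrite intrB !pmulrn; field.
have z1 : z - 1 != 0.
  (* Distinct indices below [n] satisfy [0 < |p - q| < n], which puts the angle in the required
     range. *)
  rewrite subr_eq0; apply: cis_neq1.
  have n_gt0R : 0 < n%:R :> R by rewrite ltr0n.
  have npi : 0 < 2 * pi / n%:R :> R by rewrite divr_gt0// mulr_gt0// pi_gt0.
  rewrite normrM (ger0_norm (ltW npi)) mulr_gt0//=; last first.
    by rewrite normr_gt0 subr_eq0 eqr_nat.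
  rewrite mulrAC ltr_pdivrMr// ltr_pM2l ?mulr_gt0 ?pi_gt0//.
  have := ltn_ord p; have := ltn_ord q; rewrite -!(ltr_nat R).
  have := ler0n R p; have := ler0n R q; rewrite ltr_norml; lra.
by apply: (mulfI z1); rewrite mulr0 -subrX1 zn subrr.
Qed.

Lemma phi_grid (m j : M) : phi (freq m) (grid R j) =
  \prod_(i < d) cis (2 * pi / n%:R * (j i)%:R * ((m i)%:R - (n./2)%:R)).
Proof.
rewrite phiE cis_sum; apply: eq_bigr => i _; congr cis.
by rewrite tnth_mktuple ffunE intrB mulrC !pmulrn.
Qed.

Lemma prod_natr_eq (f g : M) :
  \prod_(i < d) (n%:R * (f i == g i)%:R) = n%:R ^+ d * (f == g)%:R :> R[i].
Proof.
rewrite big_split prodr_const card_ord; congr (_ * _).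
have [->|fg] := eqVneq f g; first by rewrite big1// => i _; rewrite eqxx.
have /existsP[i fgi] : [exists i, f i != g i].
  by apply: contraNT fg => /existsPn h; apply/eqP/ffunP => i; apply/eqP/negPn/h.
by rewrite (bigD1 i)//= (negbTE fgi) mul0r.
Qed.

(** The sum over the grid factors into one-dimensional sums of roots of unity; the shift by [n/2]
    cancels in the difference of the two frequencies. *)
Lemma sum_phi_grid (m m' : M) :
  \sum_(j : M) phi (freq m) (grid R j) * (phi (freq m') (grid R j))^* =
  n%:R ^+ d * (m == m')%:R.
Proof.
rewrite -prod_natr_eq (eq_bigr _ (fun i _ => esym (sum_cis_roots (m i) (m' i)))).
rewrite bigA_distr_bigA; apply: eq_bigr => j _.
rewrite !phi_grid rmorph_prod -big_split /=; apply: eq_bigr => i _.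
by rewrite conj_cis -cisD; congr cis; ring.
Qed.

(** The dual orthogonality, summing over frequencies, is what inverts the discrete Fourier transform
    in [interpP]. Here the shift by [n/2] does not cancel: it leaves the phases [cis (t i)], which
    equal 1 when [j = l]. *)
Lemma sum_phi_freq (j l : M) :
  \sum_(m : M) phi (freq m) (grid R j) * (phi (freq m) (grid R l))^* =
  n%:R ^+ d * (j == l)%:R.
Proof.
pose t i : R := - (2 * pi / n%:R * (n./2)%:R * ((j i)%:R - (l i)%:R)).
have -> : n%:R ^+ d * (j == l)%:R =
    \prod_(i < d) (cis (t i) * (n%:R * (j i == l i)%:R)) :> R[i].
  rewrite big_split/= prod_natr_eq.
  have [jl|_] := eqVneq j l; last by rewrite !mulr0.
  by rewrite big1 ?mul1r// => i _; rewrite /t jl subrr mulr0 oppr0 cis0.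
under [RHS]eq_bigr do rewrite -sum_cis_roots mulr_sumr.
rewrite bigA_distr_bigA; apply: eq_bigr => m _.
rewrite !phi_grid rmorph_prod -big_split /=; apply: eq_bigr => i _.
by rewrite conj_cis -!cisD; congr cis; rewrite /t; ring.
Qed.

(** Discrete Parseval: the right-hand side is that of [inner_trig], so quadrature is exact for
    products [v * w^*] of elements of [Sn n]. *)
Lemma inner_n_trig (c e : M -> R[i]) :
  inner_n n (trig c) (trig e) = vol * \sum_m c m * (e m)^*.
Proof.
rewrite /inner_n rmorphM -mulrA; congr (_ * _).
transitivity ((n%:R ^- d)%:C *
  \sum_m \sum_(m' : M) c m * (e m')^* * (n%:R ^+ d * (m == m')%:R) : R[i]).
  congr (_ * _); rewrite (eq_bigr (fun j : M => \sum_m \sum_(m' : M) c m * (e m')^* *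
     (phi (freq m) (grid R j) * (phi (freq m') (grid R j))^*))); last first.
    move=> j _; rewrite /trig rmorph_sum mulr_suml; apply: eq_bigr => m _.
    rewrite mulr_sumr; apply: eq_bigr => m' _; rewrite rmorphM.
    by rewrite mulrACA.
  rewrite exchange_big; apply: eq_bigr => m _.
  rewrite exchange_big; apply: eq_bigr => m' _.
  by rewrite -mulr_sumr sum_phi_grid.
rewrite mulr_sumr; apply: eq_bigr => m _.
rewrite (bigD1 m)//= eqxx big1 ?addr0.
  rewrite mulr1 mulrCA rmorphV/= ?unitfE ?expf_neq0 ?pnatr_eq0 -?lt0n//.
  by rewrite rmorphXn rmorph_nat mulVf ?mulr1// expf_neq0// pnatr_eq0 -lt0n.
by move=> m' m'm; rewrite eq_sym (negbTE m'm) !mulr0.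
Qed.

Lemma interpP (v : Rd R d -> R[i]) : exists c : M -> R[i],
  interp n v = trig c /\ forall j : M, trig c (grid R j) = v (grid R j).
Proof.
suff [p pP] : exists p, interpolates n v p.
  have [/(SnP n_even)[c cE] gE] := xgetPex (fun=> 0) (ex_intro _ p pP).
  by exists c; rewrite -cE.
(* Coefficients of the discrete Fourier transform of the nodal values. *)
pose c (m : M) :=
  (n%:R ^- d) * \sum_(l : M) v (grid R l) * (phi (freq m) (grid R l))^*.
exists (trig c); split; first by apply/(SnP n_even); exists c.
move=> j; rewrite /trig.
transitivity (\sum_(l : M) n%:R ^- d * v (grid R l) * (n%:R ^+ d * (j == l)%:R)).
  under eq_bigr do rewrite /c mulr_sumr mulr_suml.
  rewrite exchange_big; apply: eq_bigr => l _; rewrite -sum_phi_freq mulr_sumr.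
  by apply: eq_bigr => m _; rewrite -!mulrA [X in _ * (_ * X)]mulrC.
rewrite (bigD1 j)//= eqxx big1 ?addr0; last first.
  by move=> l lj; rewrite eq_sym (negbTE lj) !mulr0.
by rewrite mulr1 mulrAC mulVf ?mul1r// expf_neq0// pnatr_eq0 -lt0n.
Qed.
End discrete_orthogonality.

(** The left-hand side is the derivative of [g] at [x] in direction [y - x], a limit of difference
    quotients as [h] decreases to 0. For [0 < h <= 1] convexity between [x] and [y] bounds each
    quotient by [g y - g x]. *)
Lemma convex_tangent (R : realType) (g g' : R -> R) (x y : R) :
  convex_fun g -> is_derivative g g' -> g' x * (y - x) <= g y - g x.
Proof.
move=> cg dg; set v := y - x.
have df : differentiable g x.
  exact/derivable1_diffP/(@ex_derive _ _ _ _ _ _ _ (dg x)).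
have -> : g' x * v = 'D_v g x.
  rewrite deriveE// -[v in RHS]mulr1 [v * 1](_ : _ = v *: (1 : R))// linearZ/=.
  by rewrite -deriveE// (@derive_val _ _ _ _ _ _ _ (dg x)) mulrC.
have dv : derivable g x v by exact: diff_derivable.
rewrite /derive (cvg_at_rightE _ _ dv).
apply: limr_le.
  by apply/cvg_ex; exists ('D_v g x); apply: cvg_dnbhs_at_right.
near=> h.
have h0 : 0 < h by near: h; exact: nbhs_right_gt.
have h1 : h <= 1 by near: h; apply: nbhs_right_le.
have := cg (Itv01 (ltW h0) h1) y x (in_setT _) (in_setT _).
rewrite !convRE/= /unstable.onem => H.
rewrite /GRing.scale/= ler_pdivrMl// lerBlDr.
have hv : h * v + x = conv (Itv01 (ltW h0) h1) (y : R^o) (x : R^o).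
  by rewrite convRE/= /unstable.onem /v; ring.
rewrite hv; apply: le_trans H _; lra.
Unshelve. all: by end_near. Qed.

(** * Energy stability *)

Section energy_identities.
Context (R : realType) (d n : nat).
Hypothesis n_gt0 : (0 < n)%N.
Hypothesis n_even : ~~ odd n.
Local Notation M := {ffun 'I_d -> 'I_n}.
Local Notation vol := ((2 * pi) ^+ d : R).

Lemma trigD (c e : M -> R[i]) x :
  trig c x + trig e x = trig (fun m => c m + e m) x.
Proof. by rewrite /trig -big_split; apply: eq_bigr => m _; rewrite mulrDl. Qed.

Lemma trigZ (a : R[i]) (c : M -> R[i]) x : a * trig c x = trig (fun m => a * c m) x.
Proof. by rewrite /trig mulr_sumr; apply: eq_bigr => m _; rewrite mulrA. Qed.

Lemma trigN (c : M -> R[i]) x : - trig c x = trig (fun m => - c m) x.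
Proof. by rewrite /trig -sumrN; apply: eq_bigr => m _; rewrite mulNr. Qed.

Lemma Re_oppc (x : R[i]) : complex.Re (- x) = - complex.Re x.
Proof. by case: x. Qed.

(** A squared modulus with values in [R]; the norm on [R[i]] takes its values in [R[i]]. *)
Definition sqmod (z : R[i]) : R := complex.Re z ^+ 2 + complex.Im z ^+ 2.

Lemma Re_mul_conj (z w : R[i]) : complex.Re (z * w^*) =
  complex.Re z * complex.Re w + complex.Im z * complex.Im w.
Proof. by case: z w => [a b] [e f]; rewrite Re_mulc /= mulrN opprK. Qed.

Lemma ReZ (a : R) (z : R[i]) : complex.Re (a%:C * z) = a * complex.Re z.
Proof. by rewrite Re_mulc /= mul0r subr0. Qed.

Lemma vol_gt0 : 0 < vol.
Proof. by rewrite exprn_gt0// mulr_gt0// pi_gt0. Qed.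

Lemma L2norm_trig_sqr (c : M -> R[i]) :
  L2norm (trig c) ^+ 2 = vol * \sum_m sqmod (c m).
Proof.
have E : complex.Re (inner (trig c) (trig c)) = vol * \sum_m sqmod (c m).
  rewrite inner_trig// ReZ Re_sumc; congr (_ * _).
  by apply: eq_bigr => m _; rewrite Re_mul_conj.
rewrite /L2norm sqr_sqrtr E//; apply: mulr_ge0; first exact: ltW vol_gt0.
by apply: sumr_ge0 => m _; rewrite addr_ge0// sqr_ge0.
Qed.

(** The zero-order and zero-mode conventions agree at orders [r / 2] and [r]. At a nonzero mode
    [Znorm] is nonzero, so the exponents add even when [r] is negative. *)
Lemma symbol_half_sqr (r : R) (k : {ffun 'I_d -> int}) :
  symbol (r / 2) k ^+ 2 = symbol r k.
Proof.
rewrite /symbol mulf_eq0 invr_eq0 pnatr_eq0 orbF; case: ifP => _.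
  by rewrite expr1n.
case: ifPn => [_|k0]; first by rewrite expr0n.
have Zk : Znorm R k != 0.
  rewrite /Znorm sqrtr_eq0 -ltNge.
  have /existsP[i ki] : [exists i, k i != 0].
    apply: contraNT k0 => /existsPn h; apply/eqP/ffunP => i.
    by rewrite ffunE; apply/eqP/negPn/h.
  rewrite (bigD1 i)//= ltr_wpDr ?sumr_ge0// => [j _|]; first exact: sqr_ge0.
  by rewrite exprn_even_gt0//= intr_eq0.
rewrite expr2 -powRD; last by rewrite (negbTE Zk) implybT.
by congr (_ `^ _); field.
Qed.

Lemma snorm_trig_sqr (r : R) (c : M -> R[i]) :
  snorm r (trig c) ^+ 2 = vol * \sum_m symbol r (freq m) * sqmod (c m).
Proof.
rewrite /snorm fracLap_trig// L2norm_trig_sqr; congr (_ * _); apply: eq_bigr => m _.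
rewrite -(symbol_half_sqr r); case: (c m) => a b.
by rewrite /sqmod Re_mulc Im_mulc /=; ring.
Qed.

(* Source of the numerical dissipation term [tau/2 |d_t u|_s^2]. *)
Lemma Re_mul_conj_dt (tau : R) (x y : R[i]) : tau != 0 ->
  let w := (tau^-1)%:C * (x - y) in
  complex.Re (x * w^*) = (sqmod x - sqmod y) / 2 / tau + tau / 2 * sqmod w.
Proof.
move=> t0 w; rewrite Re_mul_conj.
have -> : w =
    ((complex.Re x - complex.Re y) / tau) +i* ((complex.Im x - complex.Im y) / tau).
  rewrite /w; case: x y {w} => [a b] [e f].
  by apply/eqP; rewrite eq_complex /= !mul0r subr0 addr0 ![tau^-1 * _]mulrC !eqxx.
by rewrite /sqmod /=; field.
Qed.

Lemma Re_inner_n (g : R -> R) (v w : Rd R d -> R[i]) :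
  complex.Re (inner_n n (nonlin g v) w) =
  vol / n%:R ^+ d * \sum_(j : M) g (complex.Re (v (grid R j))) *
    complex.Re (w (grid R j)).
Proof.
rewrite /inner_n ReZ Re_sumc; congr (_ * _); apply: eq_bigr => j _.
by rewrite ReZ; case: (w _).
Qed.

(** The discrete inner product sees only nodal values, so an interpolant may be exchanged for the
    function it interpolates. *)
Lemma inner_n_interp (v : Rd R d -> R[i]) (a e : M -> R[i]) :
  (forall j : M, trig a (grid R j) = v (grid R j)) ->
  vol%:C * \sum_m a m * (e m)^* = inner_n n v (trig e).
Proof.
move=> av; rewrite -inner_n_trig//; congr (_ * _); apply: eq_bigr => j _.
by rewrite av.
Qed.

(** Testing the scheme with [dt tau u k], written in coefficients. Every summand vanishes on its
    own, because the scheme holds mode by mode. *)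
Lemma scheme_tested (s alpha eps tau : R) (fcx fcv : R -> R)
    (u : nat -> Rd R d -> R[i]) (k : nat) (c c' a b : M -> R[i]) :
  u k = trig c -> u k.-1 = trig c' ->
  interp n (nonlin fcx (u k)) = trig a ->
  interp n (nonlin fcv (u k.-1)) = trig b ->
  scheme s alpha eps tau fcx fcv n u k ->
  let w m := (tau^-1)%:C * (c m - c' m) in
  \sum_m ((symbol (- alpha) (freq m))%:C * w m + (symbol s (freq m))%:C * c m +
    (eps ^- 2)%:C * (a m + b m)) * (w m)^* = 0.
Proof.
move=> uc uc' ia ib sch w.
have dtE : dt tau u k = trig w.
  by apply/funext => x; rewrite /dt uc uc' trigN trigD trigZ.
pose L m := (symbol (- alpha) (freq m))%:C * w m + (symbol s (freq m))%:C * c m +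
  (eps ^- 2)%:C * a m.
pose Q m := - ((eps ^- 2)%:C * b m).
have lhsE : scheme_lhs s alpha eps tau fcx n u k = trig L.
  apply/funext => x; rewrite /scheme_lhs dtE uc -uc ia uc !fracLap_trig//.
  by rewrite trigZ !trigD.
have rhsE : scheme_rhs eps fcv n u k = trig Q.
  by apply/funext => x; rewrite /scheme_rhs ib trigZ trigN.
(* For [alpha > 0] the equation says nothing about the zero mode, where mass
   conservation makes the test function vanish instead. *)
suff LQ m : L m = Q m \/ w m = 0.
  apply: big1 => m _; case: (LQ m) => [e|->]; last by rewrite conjC0 mulr0.
  by rewrite mulrDr addrA -/(L m) e /Q addNr mul0r.
move: sch; rewrite /scheme lhsE rhsE dtE; case: ifP => _ => [e|[e0 e1]].
  by left; exact: (trig_inj e).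
have [m0|m0] := eqVneq (freq m) 0; [right|left].
  apply: (mulfI (vol_neq0 R d)); rewrite mulr0 -fourier_trig_freq -e1 m0 /fourier.
  congr inner; apply/funext => x; rewrite phiE big1 ?cis0// => i _.
  by rewrite ffunE mul0r.
apply: (mulfI (vol_neq0 R d)); rewrite -!fourier_trig_freq; exact: e0.
Qed.

End energy_identities.

(** The closing arithmetic. [P] is the sum for the [- alpha] seminorm of the increment; [S], [S'],
    [D] are the order-[s] sums for the new value, the old value and the increment; [N] is the tested
    nonlinearity and [NF], [NF'] are the discrete potentials. By the balance, the left-hand side of
    the conclusion equals [e * ((NF - NF') / tau - N)]. *)
Lemma energy_balance (R : realFieldType)
    (tau e v P S S' D N NF NF' A B E E' : R) : tau != 0 -> 0 <= e ->
  v * (P + ((S - S') / 2 / tau + tau / 2 * D)) + e * N = 0 ->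
  (NF - NF') / tau <= N ->
  A = v * P -> B = v * D ->
  E = 2^-1 * (v * S) + e * NF -> E' = 2^-1 * (v * S') + e * NF' ->
  A + tau / 2 * B + (E - E') / tau <= 0.
Proof.
move=> tau0 e0 <- /(ler_wpM2l e0) NFN -> -> -> ->.
rewrite -subr_ge0 in NFN; rewrite -subr_ge0; apply: le_trans NFN _.
by rewrite le_eqVlt; apply/orP; left; apply/eqP; field.
Qed.

Theorem mainTheorem4 (R : realType) (d : nat) (d_gt0 : (0 < d)%N)
  (s alpha eps : R) (s_gt0 : 0 < s) (alpha_ge0 : 0 <= alpha)
  (alpha_le : alpha <= s) (eps_gt0 : 0 < eps)
  (F f Fcx Fcv fcx fcv : R -> R) (nl : nonlinearity F f Fcx Fcv fcx fcv)
  (n : nat) (n_gt0 : (0 < n)%N) (n_even : ~~ odd n)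
  (tau : R) (tau_gt0 : 0 < tau) (K : nat)
  (u : nat -> Rd R d -> R[i])
  (u_Sn : forall k, (k <= K)%N -> Sn n (u k))
  (u_real : forall k, (k <= K)%N ->
     forall j : {ffun 'I_d -> 'I_n}, complex.Im (u k (grid R j)) = 0)
  (u_scheme : forall k, (1 <= k <= K)%N ->
     scheme s alpha eps tau fcx fcv n u k) :
  forall k, (1 <= k <= K)%N ->
    snorm (- alpha) (dt tau u k) ^+ 2 + tau / 2 * snorm s (dt tau u k) ^+ 2
      + (energy s eps F n (u k) - energy s eps F n (u k.-1)) / tau <= 0.
Proof.
move=> k kK.
have kK1 : (k <= K)%N by case/andP: kK.
have [c uc] := (SnP n_even _).1 (u_Sn _ kK1).
have [c' uc'] := (SnP n_even _).1 (u_Sn _ (leq_trans (leq_pred k) kK1)).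
have [a [ia ag]] := interpP n_gt0 n_even (nonlin fcx (u k)).
have [b [ib bg]] := interpP n_gt0 n_even (nonlin fcv (u k.-1)).
pose w m := (tau^-1)%:C * (c m - c' m).
have dtE : dt tau u k = trig w.
  by apply/funext => x; rewrite /dt uc uc' trigN trigD trigZ.
have tested : \sum_m ((symbol (- alpha) (freq m))%:C * w m +
    (symbol s (freq m))%:C * c m + (eps ^- 2)%:C * (a m + b m)) * (w m)^* = 0.
  exact: (scheme_tested n_even uc uc' ia ib (u_scheme _ kK)).
have tau0 : tau != 0 by rewrite gt_eqF.
pose V : R := (2 * pi) ^+ d / n%:R ^+ d.
have V_ge0 : 0 <= V by rewrite divr_ge0// ?exprn_ge0// mulr_ge0// pi_ge0.
pose P1 := \sum_m symbol (- alpha) (freq m) * sqmod (w m).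
pose P2 := \sum_m symbol s (freq m) *
  ((sqmod (c m) - sqmod (c' m)) / 2 / tau + tau / 2 * sqmod (w m)).
pose N := V * \sum_(j : {ffun 'I_d -> 'I_n})
   (fcx (complex.Re (u k (grid R j))) + fcv (complex.Re (u k.-1 (grid R j)))) *
    complex.Re (dt tau u k (grid R j)).
pose NF i := V * \sum_(j : {ffun 'I_d -> 'I_n}) F (complex.Re (u i (grid R j))).
(* Real part of the tested equation: [ReT] treats one mode, and [NE] rewrites the nonlinear terms as
   the nodal sum [N]. *)
have balance : (2 * pi) ^+ d * (P1 + P2) + eps ^- 2 * N = 0.
  have ReT m : complex.Re (((symbol (- alpha) (freq m))%:C * w m +
      (symbol s (freq m))%:C * c m + (eps ^- 2)%:C * (a m + b m)) * (w m)^*) =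
      symbol (- alpha) (freq m) * sqmod (w m) +
      symbol s (freq m) *
        ((sqmod (c m) - sqmod (c' m)) / 2 / tau + tau / 2 * sqmod (w m)) +
      eps ^- 2 * (complex.Re (a m * (w m)^*) + complex.Re (b m * (w m)^*)).
    have := Re_mul_conj_dt (c m) (c' m) tau0.
    rewrite /= -/(w m); move: (w m) => z <-.
    rewrite mulrDl [(_ + _) * _]mulrDl -!mulrA [(a m + b m) * _]mulrDl.
    rewrite !Re_addc !ReZ Re_addc.
    by rewrite [complex.Re (z * _)]Re_mul_conj /sqmod !expr2.
  have NE : N = (2 * pi) ^+ d *
      \sum_m (complex.Re (a m * (w m)^*) + complex.Re (b m * (w m)^*)).
    rewrite big_split mulrDr /= -!Re_sumc -!ReZ.
    rewrite (inner_n_interp n_gt0 w ag) (inner_n_interp n_gt0 w bg).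
    rewrite !Re_inner_n -mulrDr -dtE -big_split; congr (_ * _).
    by apply: eq_bigr => j _; rewrite mulrDl.
  rewrite NE mulrCA -mulrDr mulr_sumr -!big_split /= -(eq_bigr _ (fun m _ => ReT m)).
  by rewrite -Re_sumc tested mulr0.
have tangent : (NF k - NF k.-1) / tau <= N.
  rewrite /NF /N -mulrBr -mulrA; apply: ler_wpM2l => //.
  rewrite -sumrB mulr_suml; apply: ler_sum => j _.
  have -> : complex.Re (dt tau u k (grid R j)) =
      (complex.Re (u k (grid R j)) - complex.Re (u k.-1 (grid R j))) / tau.
    by rewrite /dt ReZ mulrC Re_addc Re_oppc.
  rewrite mulrA ler_pM2r ?invr_gt0//.
  move: (complex.Re (u k _)) (complex.Re (u k.-1 _)) => x y.
  (* With [x] the new and [y] the old nodal value, the tangent to [Fcx] is taken at [x] and the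
     tangent to [- Fcv] at [y], matching the implicit and explicit terms of the scheme. *)
  have := convex_tangent x y (convex_part nl) (convex_deriv nl).
  have dcv : is_derivative (fun x => - Fcv x) (fun x => - fcv x).
    by move=> z; apply: is_deriveN; exact: (concave_deriv nl z).
  have := convex_tangent y x (concave_part nl) dcv.
  rewrite !(potential_split nl); lra.
have energyE i (e : {ffun 'I_d -> 'I_n} -> R[i]) : u i = trig e ->
    energy s eps F n (u i) = 2^-1 * ((2 * pi) ^+ d *
      \sum_m symbol s (freq m) * sqmod (e m)) + eps ^- 2 * NF i.
  move=> ue; rewrite /energy; congr (2^-1 * _ + _ * _).
    by rewrite ue; exact: (snorm_trig_sqr n_even s e).
  by rewrite Re_inner_n; congr (_ * _); apply: eq_bigr => j _; rewrite mulr1.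
have P2E : P2 = (\sum_m symbol s (freq m) * sqmod (c m) -
     \sum_m symbol s (freq m) * sqmod (c' m)) / 2 / tau +
   tau / 2 * \sum_m symbol s (freq m) * sqmod (w m).
  rewrite -sumrB !mulr_suml mulr_sumr -big_split; apply: eq_bigr => m _ /=; ring.
have normA := snorm_trig_sqr n_even (- alpha) w.
have normS := snorm_trig_sqr n_even s w.
rewrite P2E in balance.
rewrite -dtE in normA normS.
have e2 : 0 <= eps ^- 2 by rewrite invr_ge0 sqr_ge0.
exact: (energy_balance tau0 e2 balance tangent normA normS
  (energyE _ _ uc) (energyE _ _ uc')).
Qed.
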